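(* Let $p$ be an odd prime and let $x$, $q$ be indeterminates. Then $$\sum_{k=0}^{p-1}\frac{(q;q^2)_k^2 (x;q^2)_k q^{2k}}{(q^2;q^2)_k^2 (-q^2;q^2)_k} \equiv \left(\frac{-1}{p}\right) \sum_{k=0}^{p-1}\frac{(q;q^2)_k^2 (-x;q^2)_k q^{2k}}{(q^2;q^2)_k^2 (-q^2;q^2)_k} \pmod{[p]^2}.$$
   Context: $q$ is an indeterminate. $(a;q)_0=1$ and $(a;q)_n=(1-a)(1-aq)\cdots(1-aq^{n-1})$ for $n\ge 1$; so $(a;q^m)_n=\prod_{j=0}^{n-1}(1-aq^{mj})$. $\left(\frac{\cdot}{p}\right)$ is the Legendre symbol modulo $p$. $[p]=1+q+\cdots+q^{p-1}$, which is irreducible in $\mathbb{Q}[q]$ for $p$ prime. For rational functions $A(q),B(q)\in\mathbb{Q}(q)$ whose denominators are relatively prime to $[p]$, $A\equiv B\pmod{[p]^r}$ means that $A-B$ can be written as a fraction whose numerator is divisible by $[p]^r$ in $\mathbb{Q}[q]$ and whose denominator is relatively prime to $[p]$. For polynomials in $x$ with such coefficients, congruence modulo $[p]^r$ means congruence of the coefficients of $x^k$ modulo $[p]^r$ for every $k$. *)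

(* Defs.v *)
From HB Require Import structures.
From mathcomp Require Import all_boot all_order all_algebra.

Set Implicit Arguments.
Unset Strict Implicit.
Unset Printing Implicit Defensive.

Import GRing.Theory.

Local Open Scope ring_scope.

(* Q(q): the indeterminate q is 'X in {poly rat}, embedded by tofrac. *)
Notation Qq := {fraction {poly rat}}.

Definition q : Qq := tofrac ('X : {poly rat}).

(* (a; b)_n *)
Definition qpoch (R : comPzRingType) (a b : R) (n : nat) : R :=
  \prod_(0 <= j < n) (1 - a * b ^+ j).

Definition qint (n : nat) : {poly rat} := \sum_(0 <= i < n) 'X^i.

Definition legendre (a : int) (p : nat) : int :=
  if (p %| a)%Z then 0
  else if [exists y : 'F_p, y ^+ 2 == a%:~R] then 1 else -1.

Definition denom_coprime (m : {poly rat}) (A : Qq) : Prop :=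
  exists u v : {poly rat}, coprimep v m /\ A = tofrac u / tofrac v.

(* The congruence A = B modulo m^r is only meaningful for A and B whose
   denominators are relatively prime to m; this is part of the relation. *)
Definition eqmodX (m : {poly rat}) (r : nat) (A B : Qq) : Prop :=
  [/\ denom_coprime m A,
      denom_coprime m B
    & exists u v : {poly rat},
        [/\ m ^+ r %| u, coprimep v m & A - B = tofrac u / tofrac v]].

Definition poly_eqmodX (m : {poly rat}) (r : nat) (F G : {poly Qq}) : Prop :=
  forall k : nat, eqmodX m r F`_k G`_k.

(* The sum over 0 <= k < p with z in place of x. *)
Definition qsum (p : nat) (z : {poly Qq}) : {poly Qq} :=
  \sum_(0 <= k < p)
    (qpoch q (q ^+ 2) k ^+ 2 * q ^+ (2 * k)
       / (qpoch (q ^+ 2) (q ^+ 2) k ^+ 2 * qpoch (- q ^+ 2) (q ^+ 2) k))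
    *: qpoch z (q ^+ 2)%:P k.

(* Main.v *)
Require Import Defs.
From mathcomp Require Import all_boot all_order all_algebra.
From mathcomp Require Import finfield.
From mathcomp Require Import ring zify.

Set Implicit Arguments.
Unset Strict Implicit.
Unset Printing Implicit Defensive.

Import GRing.Theory Num.Theory.

Local Open Scope ring_scope.

(** Put b = q^2 and n = (p - 1) / 2. The square (q; b)_k^2 is the middle member
    of the family (q / t; b)_k (q t; b)_k, which is symmetric under t -> 1/t, so
    moving t from 1 to q^p changes it only by a multiple of (1 - q^p)^2, hence
    of [p]^2 (lemma [locmul_sub_qpoch]). All denominators with k < p are prime
    to [p], so modulo [p]^2 the sum in x becomes, coefficient by coefficient,

      F_n(x) = sum_k (b^-n; b)_k (b^(n+1); b)_k (x; b)_k b^k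
                       / ((b; b)_k^2 (-b; b)_k),

    the big q-Legendre polynomial in base b with parameter c = -1. It is
    orthogonal for a weight symmetric about 0, so it has the parity of n:
    F_n(x) = (-1)^n F_n(-x). Algebraically, the three-term recurrence

      (1 - b^(2n+1)) x F_n = (1 - b^(n+1)) F_(n+1) + b^(n+1) (1 - b^n) F_(n-1)

    contains F_n only multiplied by x, and parity follows by induction
    (lemmas [legpolyX_rec] and [legpoly_parity]).

    Finally (-1)^n is the Legendre symbol of -1 modulo p ([legendreN1]). *)

(** * q-shifted factorials *)

Section QPochhammer.

Variable R : comPzRingType.
Implicit Types a b : R.

Lemma qpoch0 a b : qpoch a b 0 = 1.
Proof. by rewrite /qpoch big_nil. Qed.

Lemma qpochS a b k : qpoch a b k.+1 = qpoch a b k * (1 - a * b ^+ k).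
Proof. by rewrite /qpoch big_nat_recr. Qed.

Lemma qpochSl a b k : qpoch a b k.+1 = (1 - a) * qpoch (a * b) b k.
Proof.
rewrite /qpoch big_nat_recl // expr0 mulr1; congr (_ * _).
by apply: eq_bigr => j _; rewrite exprS mulrA.
Qed.

Lemma qpoch_eq0 a b j k : (j < k)%N -> a * b ^+ j = 1 -> qpoch a b k = 0.
Proof.
move=> ltjk abj; rewrite /qpoch (big_cat_nat (n := j)) ?(ltnW ltjk) //=.
by rewrite (big_ltn ltjk) abj subrr mul0r mulr0.
Qed.

End QPochhammer.

Lemma rmorph_qpoch (R S : comPzRingType) (f : {rmorphism R -> S}) a b k :
  f (qpoch a b k) = qpoch (f a) (f b) k.
Proof.
rewrite /qpoch rmorph_prod; apply: eq_bigr => j _.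
by rewrite rmorphB rmorphM rmorph1 rmorphXn.
Qed.

(** * Parity of the big q-Legendre polynomials with c = -1 *)

Section Parity.

Variables (K : fieldType) (b : K).
Hypothesis b_neq0 : b != 0.
Hypothesis b_not_root1 : forall j, (0 < j)%N -> b ^+ j != 1.

Definition legden k := qpoch b b k ^+ 2 * qpoch (- b) b k.

(** The parameter v stands for b^n. Keeping it free turns the passages
    n -> n + 1 and n -> n - 1 into v -> v b and v -> v / b, with no truncated
    subtraction. *)
Definition legcoef v k :=
  qpoch v^-1 b k * qpoch (v * b) b k * b ^+ k / legden k.

Definition legpoly v N (z : {poly K}) :=
  \sum_(0 <= k < N) legcoef v k *: qpoch z b%:P k.

Lemma subr1X_neq0 j : 1 - b ^+ j.+1 != 0.
Proof. by rewrite subr_eq0 eq_sym b_not_root1. Qed.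

(** 1 + b^(j+1) divides 1 - b^(2j+2). *)
Lemma addr1X_neq0 j : 1 + b ^+ j.+1 != 0.
Proof.
apply: contraNneq (subr1X_neq0 (j + j.+1)) => b1.
by rewrite -addSn exprD -expr2 -[1](expr1n _ 2) subr_sqr b1 mulr0.
Qed.

Lemma legdenS k :
  legden k.+1 = legden k * ((1 - b ^+ k.+1) ^+ 2 * (1 + b ^+ k.+1)).
Proof. by rewrite /legden !qpochS (exprS b); ring. Qed.

Lemma legden_neq0 k : legden k != 0.
Proof.
elim: k => [|k IHk]; first by rewrite /legden !qpoch0 expr1n mulr1 oner_eq0.
rewrite legdenS; apply: mulf_neq0 => //.
by apply: mulf_neq0; rewrite ?expf_neq0 ?subr1X_neq0 ?addr1X_neq0.
Qed.

Lemma legcoef0 v : legcoef v 0 = 1.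
Proof. by rewrite /legcoef /legden !qpoch0 expr1n !mulr1 divr1. Qed.

(** The three-term recurrence read off on the basis (z; b)_k, where
    multiplication by z acts as z (z; b)_k = b^-k ((z; b)_k - (z; b)_(k+1)). *)
Lemma legcoef_rec v k : v != 0 ->
  (1 - b * v ^+ 2) * (legcoef v k.+1 / b ^+ k.+1 - legcoef v k / b ^+ k)
  = (1 - v * b) * legcoef (v * b) k.+1
    + v * b * (1 - v) * legcoef (v / b) k.+1.
Proof.
move=> v_neq0; have bX_neq0 j : b ^+ j != 0 by rewrite expf_neq0.
have D_neq0 := legden_neq0.
rewrite /legcoef legdenS (invfM v b) (invf_div v b) (divfK b_neq0).
have := subr1X_neq0 k; have := addr1X_neq0 k.
(* For k = i + 1 every shifted factorial is a multiple of (b / v; b)_i or of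
   (v b^2; b)_i; the index k = 0 is too small for that. *)
case: k => [|i] n1 n2.
  rewrite /legden !(qpochS, qpoch0) !expr0 !expr1 in n1 n2 *.
  by field; rewrite ?b_neq0 ?v_neq0 ?n1 ?n2 ?oner_neq0.
have E1 : qpoch (v^-1 / b) b i.+2
    = (1 - v^-1 / b) * ((1 - v^-1) * qpoch (b / v) b i).
  by rewrite !qpochSl (divfK b_neq0) (mulrC b).
have E2 : qpoch v^-1 b i.+1 = (1 - v^-1) * qpoch (b / v) b i.
  by rewrite qpochSl (mulrC b).
have E3 : qpoch (v * b) b i.+1 = (1 - v * b) * qpoch (v * b * b) b i.
  by rewrite qpochSl.
have E4 : qpoch v b i.+2 = (1 - v) * ((1 - v * b) * qpoch (v * b * b) b i).
  by rewrite !qpochSl.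
rewrite E1 E4 (qpochS v^-1) (qpochS (v * b)) E2 E3.
rewrite !(qpochS _ _ i.+1) !(qpochS _ _ i).
move: (D_neq0 i.+1); move: (qpoch _ _ _) (qpoch _ _ _) (legden _) => w h D nD.
rewrite !(exprS b) in n1 n2 *; move: (bX_neq0 i) n1 n2; move: (b ^+ i) => t n0 n1 n2.
by field; rewrite n1 n2 nD v_neq0 b_neq0 n0.
Qed.

(** For an arbitrary v the sum does not terminate, and truncating it leaves the
    single boundary term on the right; it disappears when v = b^n with n < N. *)
Lemma legpoly_rec v N z : v != 0 ->
  (1 - b * v ^+ 2) *: (z * legpoly v N.+1 z)
  = (1 - v * b) *: legpoly (v * b) N.+1 z
    + (v * b * (1 - v)) *: legpoly (v / b) N.+1 z
    - ((1 - b * v ^+ 2) * (legcoef v N / b ^+ N)) *: qpoch z b%:P N.+1.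
Proof.
move=> v_neq0; rewrite /legpoly; elim: N => [|N IHN].
  rewrite !big_nat1 qpochS !qpoch0 !legcoef0 !expr0 divr1 !mulr1 !scale1r.
  rewrite mul1r mulr1 scalerBr opprB addrCA -!scalerDl.
  have -> : 1 - v * b + v * b * (1 - v) = 1 - b * v ^+ 2 by ring.
  by rewrite subrr addr0.
rewrite big_nat_recr //= [in X in _ = X]big_nat_recr //=.
rewrite [X in _ = _ + _ *: X - _]big_nat_recr //=.
set W := qpoch z b%:P N.+1 in IHN *.
rewrite mulrDr scalerDr {}IHN.
have zW : z * W = b ^- N.+1 *: (W - qpoch z b%:P N.+2).
  rewrite [qpoch _ _ N.+2]qpochS -/W -rmorphXn /= mulrBr mulr1 opprB addrC subrK.
  rewrite mulrA [_ * _%:P]mulrC mul_polyC scalerA mulVf ?expf_neq0 //.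
  by rewrite scale1r mulrC.
have rec : (1 - b * v ^+ 2) * (legcoef v N.+1 / b ^+ N.+1)
    = (1 - b * v ^+ 2) * (legcoef v N / b ^+ N)
      + ((1 - v * b) * legcoef (v * b) N.+1
         + v * b * (1 - v) * legcoef (v / b) N.+1).
  by rewrite -legcoef_rec // mulrBr [RHS]addrC subrK.
move: (1 - b * v ^+ 2) (1 - v * b) (v * b * (1 - v)) rec => e e1 e2 rec.
rewrite -scalerAr zW 2!scalerA -[e * _ / _]mulrA scalerBr {1}rec !scalerDl.
rewrite !scalerDr !scalerA.
have add_cancel (V : zmodType) (A B C D E F : V) :
    A + B - C + (C + (D + E) - F) = A + D + (B + E) - F.
  by rewrite -!addrA (addrA (- C)) addNr add0r (addrCA B).
exact: add_cancel.
Qed.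

(** (b^-n; b)_k contains the factor 1 - b^-n b^n. *)
Lemma legcoef_gt n k : (n < k)%N -> legcoef (b ^+ n) k = 0.
Proof.
move=> ltnk; rewrite /legcoef (@qpoch_eq0 _ _ _ n) ?mul0r //.
by rewrite mulVf ?expf_neq0.
Qed.

(** For n = 0 the predecessor is a dummy: its coefficient 1 - b^0 vanishes. *)
Lemma legpolyX_rec n N z : (n.+1 < N)%N ->
  legpoly (b ^+ n.+1) N z = (1 - b ^+ n.+1)^-1 *:
    ((1 - b ^+ (n + n).+1) *: (z * legpoly (b ^+ n) N z)
     - (b ^+ n.+1 * (1 - b ^+ n)) *: legpoly (b ^+ n.-1) N z).
Proof.
case: N => // N; rewrite ltnS => ltnN.
have bn_neq0 : b ^+ n != 0 by rewrite expf_neq0.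
have := legpoly_rec N z bn_neq0.
rewrite legcoef_gt // mul0r mulr0 scale0r subr0 -exprSr.
rewrite expr2 -exprD -exprS => ->.
have -> : (b ^+ n.+1 * (1 - b ^+ n)) *: legpoly (b ^+ n / b) N.+1 z
    = (b ^+ n.+1 * (1 - b ^+ n)) *: legpoly (b ^+ n.-1) N.+1 z.
  case: (n) => [|m]; first by rewrite subrr mulr0 !scale0r.
  by rewrite -[in b ^+ m.+1 / b]addn1 exprD expr1 mulfK.
by rewrite addrK scalerA mulVf ?scale1r ?subr1X_neq0.
Qed.

Lemma legpoly1 N z : legpoly 1 N.+1 z = 1.
Proof.
rewrite /legpoly big_ltn // big_nat big1 => [|k /andP[lt0k _]].
  by rewrite legcoef0 qpoch0 scale1r addr0.
by rewrite -(expr0 b) legcoef_gt ?scale0r.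
Qed.

Lemma legpoly_parity n N z : (n < N)%N ->
  legpoly (b ^+ n) N z = (-1) ^+ n *: legpoly (b ^+ n) N (- z).
Proof.
have [m] := ubnP n; elim: m n => // m IHm [|n] leqnm ltnN.
  by rewrite expr0 scale1r -(prednK ltnN) !legpoly1.
rewrite !legpolyX_rec // [in LHS]IHm ?(ltnW ltnN) //.
(* The sign (-1)^(n-1) is written (-1)^(n+1) so as to cover n = 0. *)
have -> : (b ^+ n.+1 * (1 - b ^+ n)) *: legpoly (b ^+ n.-1) N z
    = (-1) ^+ n.+1 *:
      ((b ^+ n.+1 * (1 - b ^+ n)) *: legpoly (b ^+ n.-1) N (- z)).
  case: n leqnm ltnN => [|n] ltnm ltnN.
    by rewrite subrr mulr0 !scale0r scaler0.
  rewrite IHm ?(ltnW (ltnW ltnN)) //; last exact: ltnW.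
  by rewrite !scalerA mulrC !exprS !mulN1r opprK.
rewrite (exprS (-1)) mulN1r mulNr scalerN scaleNr -!scalerAr.
rewrite [in RHS]scalerA [in RHS]mulrC -[RHS]scalerA; congr (_ *: _).
rewrite opprK -opprD scaleNr scalerN opprK scalerDr.
by congr (_ + _); rewrite !scalerA mulrC.
Qed.

End Parity.

(** * Multiples of a power of m in the localization of Q[q] at m *)

Section Localization.

Variable m : {poly rat}.
Hypothesis size_m : (1 < size m)%N.

Definition locmul r (A : Qq) : Prop := exists u v : {poly rat},
  [/\ m ^+ r %| u, coprimep v m & A = tofrac u / tofrac v].

Lemma denom_coprimeP A : denom_coprime m A <-> locmul 0 A.
Proof.
by split=> [[u [v [co ->]]]|[u [v [_ co ->]]]]; exists u, v;
  rewrite ?expr0 ?dvd1p.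
Qed.

(** A nonzero constant m is coprime to 0, which [size_m] excludes. *)
Lemma coprimep_neq0 v : coprimep v m -> tofrac v != 0.
Proof.
rewrite tofrac_eq0; apply: contraTneq => ->.
by rewrite coprime0p -size_poly_eq1 neq_ltn size_m orbT.
Qed.

Lemma locmul_tofrac r u : m ^+ r %| u -> locmul r (tofrac u).
Proof. by move=> mu; exists u, 1; rewrite coprime1p tofrac1 divr1. Qed.

Lemma locmul0 r : locmul r 0.
Proof. by rewrite -tofrac0; apply: locmul_tofrac; apply: dvdp0. Qed.

Lemma locmulD r A B : locmul r A -> locmul r B -> locmul r (A + B).
Proof.
move=> [u [v [mu cv ->]]] [u' [v' [mu' cv' ->]]].
exists (u * v' + u' * v), (v * v'); split.
- by rewrite dvdp_add // dvdp_mulr.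
- by rewrite coprimepMl cv.
by rewrite addf_div ?coprimep_neq0 // tofracD !tofracM.
Qed.

Lemma locmulN r A : locmul r A -> locmul r (- A).
Proof.
move=> [u [v [mu cv ->]]]; exists (- u), v; split=> //.
  by rewrite dvdpNr.
by rewrite tofracN mulNr.
Qed.

Lemma locmulM r s A B : locmul r A -> locmul s B -> locmul (r + s) (A * B).
Proof.
move=> [u [v [mu cv ->]]] [u' [v' [mu' cv' ->]]].
exists (u * u'), (v * v'); split.
- by rewrite exprD dvdp_mul.
- by rewrite coprimepMl cv.
by rewrite mulf_div !tofracM.
Qed.

Lemma locmulW r A : locmul r A -> locmul 0 A.
Proof. by move=> [u [v [_ cv ->]]]; exists u, v; rewrite expr0 dvd1p. Qed.

Lemma locmul0_tofrac u : locmul 0 (tofrac u).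
Proof. by apply: locmul_tofrac; rewrite expr0 dvd1p. Qed.

Lemma locmul_sum r (I : Type) (s : seq I) (P : pred I) (F : I -> Qq) :
  (forall i, P i -> locmul r (F i)) -> locmul r (\sum_(i <- s | P i) F i).
Proof. by move=> LF; elim/big_ind: _ => //; [apply: locmul0 | apply: locmulD]. Qed.

Lemma locmulV u : coprimep u m -> locmul 0 (tofrac u)^-1.
Proof. by move=> cu; exists 1, u; rewrite expr0 dvd1p tofrac1 div1r. Qed.

End Localization.

(** * Polynomials prime to [p], and the Legendre symbol of -1 *)

Lemma coprimepX_qint p k : (0 < p)%N -> coprimep 'X^k (qint p).
Proof.
move=> p_gt0; apply: coprimep_expl; rewrite coprimep_sym coprimepX /root.
rewrite /qint horner_sum big_ltn // big_nat big1 => [|i /andP[i_gt0 _]].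
  by rewrite hornerXn expr0 addr0 oner_eq0.
by rewrite hornerXn expr0n gtn_eqF.
Qed.

Lemma qintE p : qint p * ('X - 1) = 'X^p - 1.
Proof. by rewrite subrX1 mulrC /qint big_mkord. Qed.

Lemma size_qint p : size (qint p) = p.
Proof.
case: p => [|p]; first by rewrite /qint big_nil size_poly0.
have := congr1 (fun P : {poly rat} => size P) (qintE p.+1).
have q0 : qint p.+1 != 0.
  apply/eqP => q0; have := coprimepX_qint 1 (ltn0Sn p).
  by rewrite q0 coprimep0 -size_poly_eq1 size_polyX.
by rewrite size_XnsubC // size_Mmonic ?monicXsubC // size_XsubC addn2 => -[].
Qed.

(** A common divisor divides X^k - 1 and X^p - 1, hence X - 1 since k and p are
    coprime; but X - 1 is prime to [p], whose value at 1 is p. *)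
Lemma coprimep_subX1_qint p k : prime p -> ~~ (p %| k)%N ->
  coprimep (1 - 'X^k) (qint p).
Proof.
move=> p_pr pNk.
apply/coprimepP => d dk dp.
have k_gt0 : (0 < k)%N by case: k pNk {dk}; rewrite ?dvdn0.
have dX a j : d %| 'X^j - 1 -> d %| 'X^(a * j) - 1.
  move=> dX1; apply: dvdp_trans dX1 _.
  by rewrite mulnC exprM [X in _ %| X]subrX1 dvdp_mulr.
have dpX : d %| 'X^p - 1 by rewrite -qintE dvdp_mulr.
have dkX : d %| 'X^k - 1 by rewrite -dvdpNr opprB.
have co : coprime k p by rewrite coprime_sym prime_coprime.
case: (egcdnP p k_gt0) => u v; rewrite (eqP co) => uv _.
have dX1 : d %| 'X - 1.
  have -> : 'X - 1 = 'X^(u * k) - 1 - 'X * ('X^(v * p) - 1) :> {poly rat}.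
    by rewrite uv addn1 exprS mulrBr mulr1 opprB [RHS]addrC addrA subrK.
  by apply: dvdp_sub; [exact: dX | exact/dvdp_mull/dX].
have co1 : coprimep ('X - 1) (qint p).
  rewrite coprimep_sym coprimep_XsubC /root /qint horner_sum.
  rewrite (eq_bigr (fun=> 1)) => [|i _]; last by rewrite hornerXn expr1n.
  by rewrite sumr_const_nat subn0 pnatr_eq0 -lt0n prime_gt0.
by move/coprimepP: co1; apply.
Qed.

(** If y^2 = -1, then 1 = y^(p-1) = (-1)^n. Conversely, if n is even and -1 is
    not a square, then no y satisfies y^n = -1, so all p - 1 = 2n nonzero
    elements are roots of X^n - 1, which is too many. *)
Lemma legendreN1 p : prime p -> odd p -> legendre (-1) p = (-1) ^+ p./2.
Proof.
move=> p_pr p_odd; set n := p./2.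
have pE : p = (n + n).+1 by rewrite addnn -[LHS]odd_double_half p_odd.
have n_gt0 : (0 < n)%N by case: (n) pE p_pr => // ->.
have flt (y : 'F_p) : y != 0 -> (y ^+ n) ^+ 2 = 1.
  move=> y0; apply: (mulfI y0).
  rewrite mulr1 -exprM -exprS muln2 -addnn -pE.
  by rewrite -[in X in _ ^+ X](card_Fp p_pr) expf_card.
have N1 : (-1 : 'F_p) != 1.
  rewrite eq_sym -subr_eq0 opprK -(natrD _ 1 1) -(dvdn_pcharf (pchar_Fp p_pr)).
  by rewrite dvdn_prime2 //; apply: contraTneq p_odd => ->.
rewrite /legendre dvdzE /= dvdn1 gtn_eqF ?prime_gt1 //.
case: existsP => [[y /eqP y2]|noroot].
  have y0 : y != 0.
    by apply: contra_eq_neq y2 => ->; rewrite expr0n eq_sym oppr_eq0 oner_eq0.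
  have := flt y y0; rewrite -exprM mulnC exprM y2 rmorphN rmorph1.
  rewrite -(signr_odd 'F_p) -(signr_odd int).
  by case: (odd n) => // /eqP; rewrite expr1 (negPf N1).
rewrite -signr_odd; have [//|n_even] := boolP (odd n).
have rootn (y : 'F_p) : y != 0 -> y ^+ n = 1.
  move=> y0; have /eqP := flt y y0; rewrite sqrf_eq1 => /orP[/eqP //|/eqP yn].
  case: noroot; exists (y ^+ n./2); rewrite -exprM muln2 even_halfK //.
  by rewrite yn rmorphN rmorph1.
have := @max_poly_roots _ ('X^n - 1 : {poly 'F_p}) (enum (predC1 0)).
rewrite -size_poly_gt0 size_XnsubC // => /(_ isT).
rewrite enum_uniq -cardE cardC1 card_Fp // => H.
have : (p.-1 < n.+1)%N.
  apply: H => //; apply/allP => y; rewrite mem_enum => y0.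
  by rewrite /root hornerD hornerN hornerC hornerXn rootn // subrr.
by move: pE n_gt0; lia.
Qed.

(** * The summand modulo [p]^2 *)

(** One more factor of (q; q^2)_k^2 and of its deformation, with t = q^(2k):
    the whole discrepancy rests on the identity
    (1 - y)^2 - (1 - y / s) (1 - y s) = y (1 - s)^2 / s for y = q t, s = q v. *)
Lemma deform_step (K : fieldType) (q v t x y z : K) : q != 0 -> v != 0 ->
  (x * (1 - q * t)) ^+ 2 - y * (1 - v^-1 * t) * (z * (1 - v * q ^+ 2 * t))
  = (x ^+ 2 - y * z) * (1 - q * t) ^+ 2
    + (1 - q * v) ^+ 2 * (y * z * (q * t * (q * v)^-1)).
Proof. by move=> q_neq0 v_neq0; field; rewrite q_neq0 v_neq0. Qed.

Section Congruence.

Variable p : nat.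
Hypotheses (p_pr : prime p) (p_odd : odd p).

Let b := q ^+ 2.
Let v := q ^+ p.-1.

Local Notation locmul := (locmul (qint p)).

Lemma size_qint_gt1 : (1 < size (qint p))%N.
Proof. by rewrite size_qint prime_gt1. Qed.

Lemma qXE k : q ^+ k = tofrac 'X^k.
Proof. by rewrite tofracXn. Qed.

(** The factors 1 - q^(2j) and 1 + q^(2j) with 0 < j < p both divide
    1 - q^(4j), and p does not divide 4j. *)
Lemma coprimep_legden k : (k < p)%N ->
  exists2 u, coprimep u (qint p) & legden b k = tofrac u.
Proof.
elim: k => [|k IHk] ltkp.
  exists 1; first exact: coprime1p.
  by rewrite /legden !qpoch0 expr1n mulr1 tofrac1.
have [u cu uE] := IHk (ltnW ltkp).
have cop i : ~~ (p %| i)%N -> coprimep (1 - 'X^i) (qint p).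
  exact: coprimep_subX1_qint.
have pN : ~~ (p %| k.+1)%N by rewrite gtnNdvd.
have pN2 : ~~ (p %| 2)%N.
  by rewrite dvdn_prime2 //; apply: contraTneq p_odd => ->.
have c1 : coprimep (1 - 'X^(2 * k.+1)) (qint p).
  by apply: cop; rewrite Euclid_dvdM // negb_or pN2.
have c2 : coprimep (1 + 'X^(2 * k.+1)) (qint p).
  have : coprimep (1 - 'X^(2 * k.+1 * 2)) (qint p).
    by apply: cop; rewrite !Euclid_dvdM // !negb_or pN2 pN.
  rewrite exprM -[X in X - _](expr1n _ 2) subr_sqr coprimepMl.
  by case/andP.
exists (u * ((1 - 'X^(2 * k.+1)) ^+ 2 * (1 + 'X^(2 * k.+1)))).
  by rewrite !coprimepMl cu c1 c2.
rewrite legdenS uE /b -exprM qXE.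
by rewrite !(tofracM, tofracXn, tofracD, tofracN, tofrac1).
Qed.

Lemma locmul0_qX i : locmul 0 (q ^+ i).
Proof. by rewrite qXE; apply: locmul0_tofrac. Qed.

Lemma locmul0_mul x y : locmul 0 x -> locmul 0 y -> locmul 0 (x * y).
Proof. by move=> Lx Ly; rewrite -[0%N]addn0; apply: locmulM. Qed.

Lemma locmul0_sub x y : locmul 0 x -> locmul 0 y -> locmul 0 (x - y).
Proof.
by move=> Lx Ly; apply: (locmulD size_qint_gt1) => //; apply: locmulN.
Qed.

Lemma locmul0_qpoch k : locmul 0 (qpoch q b k ^+ 2).
Proof.
have L i : locmul 0 (qpoch q b i).
  elim: i => [|i IHi]; first by rewrite qpoch0 -(expr0 q); apply: locmul0_qX.
  rewrite qpochS /b -exprM -exprS; apply: locmul0_mul => //.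
  by apply: locmul0_sub; rewrite -?(expr0 q); apply: locmul0_qX.
by rewrite expr2; apply: locmul0_mul.
Qed.

(** Here v^-1 = q / q^p and v b = q q^p. This also covers k > n, where the
    deformed product vanishes and (q; b)_k contains the factor 1 - q^p. *)
Lemma locmul_sub_qpoch k :
  locmul 2 (qpoch q b k ^+ 2 - qpoch v^-1 b k * qpoch (v * b) b k).
Proof.
have q_neq0 : q != 0 by rewrite tofrac_eq0 polyX_eq0.
have qpE : q * v = q ^+ p by rewrite -exprS prednK ?prime_gt0.
have loc2 : locmul 2 ((1 - q * v) ^+ 2).
  rewrite qpE qXE -tofrac1 -tofracB -tofracXn; apply: locmul_tofrac.
  by rewrite dvdp_exp2r // -dvdpNr opprB -qintE dvdp_mulr.
elim: k => [|k IHk]; first by rewrite !qpoch0 expr1n mulr1 subrr; apply: locmul0.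
set A := _ ^+ 2 in IHk; set B := _ * _ in IHk.
have LB : locmul 0 B.
  rewrite -(subKr A B); apply: locmul0_sub; last exact: locmulW IHk.
  exact: locmul0_qpoch.
have v_neq0 : v != 0 by rewrite expf_neq0.
have -> : qpoch q b k.+1 ^+ 2 - qpoch v^-1 b k.+1 * qpoch (v * b) b k.+1
   = (A - B) * (1 - q * b ^+ k) ^+ 2
     + (1 - q * v) ^+ 2 * (B * (q * b ^+ k * (q * v)^-1)).
  by rewrite !qpochS; apply: (@deform_step _ q v _ _ _ _ q_neq0 v_neq0).
have Ly : locmul 0 (q * b ^+ k) by rewrite /b -exprM -exprS; apply: locmul0_qX.
apply: (locmulD size_qint_gt1); rewrite -[2%N]addn0; apply: locmulM => //.
  rewrite expr2; apply: locmul0_mul; apply: locmul0_sub => //;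
    by rewrite -(expr0 q); apply: locmul0_qX.
apply: locmul0_mul => //; apply: locmul0_mul => //.
by rewrite qpE qXE; apply: locmulV; apply: coprimepX_qint; apply: prime_gt0.
Qed.

(** The coefficients of (z; b)_k lie in Q[q] when z comes from Q[q][x], so a
    bound on the scalar factors passes to every coefficient of the sum. *)
Lemma locmul_coef_sum r (c : nat -> Qq) (Z : {poly {poly rat}}) i :
  (forall k, (k < p)%N -> locmul r (c k)) ->
  locmul r (\sum_(0 <= k < p)
     c k *: qpoch (map_poly (@tofrac _) Z) b%:P k)`_i.
Proof.
move=> Lc; rewrite coef_sum big_nat_cond.
apply: (locmul_sum size_qint_gt1) => k; rewrite andbT /= => ltkp.
have -> : b%:P = map_poly (@tofrac {poly rat}) ('X ^+ 2)%:P.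
  by rewrite map_polyC /b qXE.
rewrite -rmorph_qpoch coefZ coef_map -[r]addn0.
by apply: locmulM; [exact: Lc | apply: locmul_tofrac; rewrite expr0 dvd1p].
Qed.

Lemma locmul_qsum (Z : {poly {poly rat}}) i :
  let z := map_poly (@tofrac _) Z in
  locmul 0 (qsum p z)`_i /\ locmul 2 (qsum p z - legpoly b v p z)`_i.
Proof.
move=> z; rewrite /qsum /legpoly -sumrB.
have loc_den k : (k < p)%N -> locmul 0 (q ^+ (2 * k) / legden b k).
  move=> /coprimep_legden[u cu ->]; rewrite -[0%N]addn0; apply: locmulM.
    by rewrite qXE; apply: locmul0_tofrac.
  exact: locmulV.
split.
  apply: locmul_coef_sum => k ltkp; rewrite -mulrA -[0%N]addn0.
  apply: locmulM; last exact: loc_den.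
  exact: locmul0_qpoch.
under eq_bigr do rewrite -scalerBl.
apply: locmul_coef_sum => k ltkp.
rewrite /legcoef /b -exprM -/b -[X in X - _]mulrA -[X in _ - X]mulrA -mulrBl.
rewrite -[2%N]addn0; apply: locmulM; last exact: loc_den.
exact: locmul_sub_qpoch.
Qed.

End Congruence.

(** * The congruence *)

Theorem theorem2p5 (p : nat) (hp : prime p) (hodd : odd p) :
  poly_eqmodX (qint p) 2
    (qsum p 'X)
    ((legendre (-1) p)%:~R *: qsum p (- 'X)).
Proof.
move=> i; rewrite legendreN1 // rmorphXn rmorphN1.
have b_neq0 : q ^+ 2 != 0 by rewrite expf_neq0 // tofrac_eq0 polyX_eq0.
have b_nroot j : (0 < j)%N -> (q ^+ 2) ^+ j != 1.
  move=> j_gt0; rewrite -exprM qXE -tofrac1 tofrac_eq -subr_eq0.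
  by rewrite -size_poly_eq0 size_XnsubC ?muln_gt0.
have lt_half : (p./2 < p)%N by have := prime_gt0 hp; lia.
have par := @legpoly_parity _ _ b_neq0 b_nroot p./2 p 'X lt_half.
have [L0 L2] := locmul_qsum hp hodd 'X i.
have [L0' L2'] := locmul_qsum hp hodd (- 'X) i.
rewrite ?rmorphN /= ?map_polyX in L0 L2 L0' L2'.
have vE : (q ^+ 2) ^+ p./2 = q ^+ p.-1.
  by rewrite -exprM mul2n -[in RHS](odd_double_half p) hodd.
rewrite vE in par.
have locs : locmul (qint p) 0 ((-1) ^+ p./2).
  by rewrite -tofrac1 -tofracN -tofracXn; apply: locmul0_tofrac.
split; first exact/denom_coprimeP.
  by apply/denom_coprimeP; rewrite coefZ; apply: locmul0_mul.
have -> : (qsum p 'X)`_i - ((-1) ^+ p./2 *: qsum p (- 'X))`_i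
  = (qsum p 'X - legpoly (q ^+ 2) (q ^+ p.-1) p 'X)`_i
    - (-1) ^+ p./2 * (qsum p (- 'X) - legpoly (q ^+ 2) (q ^+ p.-1) p (- 'X))`_i.
  by rewrite par !coefB !coefZ mulrBr opprB addrA subrK.
apply: (locmulD (size_qint_gt1 hp)) => //; last apply: locmulN.
by apply: (@locmulM (qint p) 0 2).
Qed.
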